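(* Let $(g,J,F,\theta)$ be an LCAK structure on a manifold $M$. Then $g$ is an anti-pluricanonical LCAK metric if and only if $T=\theta^\sharp$ is a (real) holomorphic vector field, i.e. $\mathcal{L}_TJ=0$.
   Context: An LCAK (locally conformally almost Kähler) structure $(g,J,F,\theta)$ on a manifold $M$ of real dimension $2n$ consists of an almost complex structure $J$ (not necessarily integrable), a non-degenerate $2$-form $F$ and a closed $1$-form $\theta$ (the Lee form) with $dF=\theta\wedge F$, such that $g:=F(\cdot,J\cdot)$ is a Riemannian metric. $T=\theta^\sharp$ is the $g$-dual of $\theta$ and $D$ the Levi-Civita connection of $g$. The Nijenhuis tensor is $4N(X,Y)=[JX,JY]-[X,Y]-J[JX,Y]-J[X,JY]$. The LCAK metric $g$ is anti-pluricanonical if the image of $N$ is $g$-orthogonal to $\mathrm{Span}(T,JT)$ and the $2$-tensor $(D\theta)(X,Y)=(D_X\theta)(Y)$ is $J$-invariant, i.e. $(D\theta)(JX,JY)=(D\theta)(X,Y)$ for all $X,Y$. *)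

(* Defs.v *)
(* Smooth manifolds are given by an explicit atlas.  Differential geometry is
   then written over the commutative ring C(M) of smooth functions: vector
   fields are the R-linear derivations of C(M), and tensor fields are
   C(M)-multilinear maps on the C(M)-module X(M) of vector fields. *)
From HB Require Import structures.
From mathcomp Require Import all_boot all_order all_algebra.
From mathcomp Require Import all_classical all_reals all_analysis.
Set Implicit Arguments.
Unset Strict Implicit.
Unset Printing Implicit Defensive.
Import Order.TTheory GRing.Theory Num.Theory numFieldNormedType.Exports.
Local Open Scope classical_set_scope.
Local Open Scope ring_scope.

Section EuclideanSmoothness.
Context {R : realType} {m : nat}.
Implicit Types (U : set 'rV[R]_m) (f g : 'rV[R]_m -> R).

(* Only used for open U, so that the partial derivatives at points of U do not
   depend on the values of f outside U. *)
Fixpoint Ck_on U (k : nat) f : Prop :=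
  (forall x, U x -> {for x, continuous f}) /\
  if k is k'.+1 then
    forall i : 'I_m,
      (forall x, U x -> derivable f x (delta_mx 0 i)) /\
      Ck_on U k' (fun x => 'D_(delta_mx 0 i) f x)
  else True.

Definition smooth_on U f := forall k, Ck_on U k f.

Lemma Ck_onS U k f : Ck_on U k.+1 f -> Ck_on U k f.
Proof.
elim: k f => [|k IH] f [fc fd]; split=> // i.
by have [? ?] := fd i; split=> //; apply: IH.
Qed.

Lemma Ck_on_eq U k f g : open U -> {in U, f =1 g} -> Ck_on U k f -> Ck_on U k g.
Proof.
move=> oU; elim: k f g => [|k IH] f g fg [fc fd].
all: have nfg x : U x -> \near x, f x = g x
  by move=> Ux; apply: filterS (open_nbhs_nbhs (conj oU Ux)) => y Uy;
     apply: fg; rewrite inE.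
all: split=> [x Ux|]; first by
  have := fc x Ux; rewrite /prop_for /continuous_at (fg x) ?inE//;
  apply: cvg_trans; exact: near_eq_cvg (nfg x Ux).
- by [].
move=> i; have [d1 d2] := fd i; split=> [x Ux|].
  exact: near_eq_derivable (nfg x Ux) (d1 x Ux).
apply: IH d2 => x; rewrite inE => Ux; exact: near_eq_derive (nfg x Ux).
Qed.

Lemma Ck_on_cst U k (r : R) : Ck_on U k (cst r).
Proof.
elim: k r => [|k IH] r; (split; first by move=> x _; exact: cst_continuous) => //.
move=> i; split=> [x _|]; first exact: derivable_cst.
rewrite (_ : (fun x => _) = cst 0) ?funeqE// => x; exact: derive_cst.
Qed.

Lemma Ck_onB U k f g : open U -> Ck_on U k f -> Ck_on U k g ->
  Ck_on U k (f - g).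
Proof.
move=> oU; elim: k f g => [|k IH] f g [fc fd] [gc gd].
all: split=> [x Ux|]; first by apply: continuousB; [exact: fc|exact: gc].
- by [].
move=> i; have [f1 f2] := fd i; have [g1 g2] := gd i; split=> [x Ux|].
  by apply: derivableB; [exact: f1|exact: g1].
apply: Ck_on_eq (IH _ _ f2 g2) => // x; rewrite inE => Ux.
by rewrite deriveB//; [exact: f1|exact: g1].
Qed.

Lemma Ck_onD U k f g : open U -> Ck_on U k f -> Ck_on U k g ->
  Ck_on U k (f + g).
Proof.
move=> oU fk gk; rewrite -[g]opprK -[- g]sub0r; do 2?apply: Ck_onB => //.
exact: Ck_on_cst.
Qed.

Lemma Ck_onM U k f g : open U -> Ck_on U k f -> Ck_on U k g ->
  Ck_on U k (f * g).
Proof.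
move=> oU; elim: k f g => [|k IH] f g fk gk.
all: have [fc fd] := fk; have [gc gd] := gk.
all: split=> [x Ux|]; first by apply: continuousM; [exact: fc|exact: gc].
- by [].
move=> i; have [f1 f2] := fd i; have [g1 g2] := gd i; split=> [x Ux|].
  by apply: derivableM; [exact: f1|exact: g1].
apply: Ck_on_eq (Ck_onD oU (IH _ _ (Ck_onS fk) g2) (IH _ _ (Ck_onS gk) f2)) => //.
move=> x; rewrite inE => Ux.
by rewrite deriveM//; [exact: f1|exact: g1].
Qed.

End EuclideanSmoothness.

Record chart (R : realType) (m : nat) (M : topologicalType) := Chart {
  chart_dom : set M;
  chart_map : M -> 'rV[R]_m;
  chart_inv : 'rV[R]_m -> M;
  chart_dom_open : open chart_dom;
  chart_cod_open : open (chart_map @` chart_dom);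
  chart_mapK : {in chart_dom, cancel chart_map chart_inv};
  chart_map_continuous : {within chart_dom, continuous chart_map};
  chart_inv_continuous :
    {within chart_map @` chart_dom, continuous chart_inv} }.

(* Smooth manifold of dimension m; the atlas need not be maximal. *)
Record manifold (R : realType) (m : nat) := Manifold {
  manifold_sort :> topologicalType;
  atlas : set (chart R m manifold_sort);
  manifold_hausdorff : hausdorff_space manifold_sort;
  manifold_second_countable : @second_countable manifold_sort;
  atlas_cover : forall p, exists2 c, atlas c & chart_dom c p;
  atlas_smooth : forall c d, atlas c -> atlas d -> forall j : 'I_m,
    smooth_on (chart_map c @` (chart_dom c `&` chart_dom d))
              (fun x => chart_map d (chart_inv c x) 0 j) }.

Section SmoothFunctions.
Context {R : realType} {m : nat} (M : manifold R m).

Definition smooth (f : M -> R) := forall c, atlas c ->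
  smooth_on (chart_map c @` chart_dom c) (f \o chart_inv c).

Definition smooth_pred : pred (M -> R) := fun f => `[< smooth f >].

Lemma smooth_subring_closed : GRing.subring_closed smooth_pred.
Proof.
split=> [|f g /asboolP fs /asboolP gs|f g /asboolP fs /asboolP gs];
  apply/asboolP => c ca k.
- exact: Ck_on_cst.
- by apply: Ck_onB; [exact: chart_cod_open|exact: fs|exact: gs].
- by apply: Ck_onM; [exact: chart_cod_open|exact: fs|exact: gs].
Qed.

HB.instance Definition _ :=
  GRing.isSubringClosed.Build (M -> R) smooth_pred smooth_subring_closed.

Lemma smooth_scaler_closed : GRing.scaler_closed smooth_pred.
Proof.
move=> r f /asboolP fs; apply/asboolP => c ca k.
by apply: Ck_onM; [exact: chart_cod_open|exact: Ck_on_cst|exact: fs].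
Qed.

HB.instance Definition _ :=
  GRing.isScaleClosed.Build R (M -> R) smooth_pred smooth_scaler_closed.

Record smoothFun := SmoothFun {
  smooth_val :> M -> R;
  smooth_valP : smooth_val \in smooth_pred }.

HB.instance Definition _ := [isSub for smooth_val].
HB.instance Definition _ := [Choice of smoothFun by <:].
HB.instance Definition _ := 
  GRing.SubChoice_isSubComPzRing.Build _ _ smoothFun (GRing.subringClosedP _).
HB.instance Definition _ := [SubZmodule_isSubLmodule of smoothFun by <:].

End SmoothFunctions.

Section VectorFields.
Context {R : realType} {m : nat} (M : manifold R m).
Local Notation C := (smoothFun M).

Definition derivation (X : C -> C) :=
  linear X /\ forall a b : C, X (a * b) = X a * b + a * X b.

(* The codomain C^o makes the ambient function space a C-module. *)
Definition derivation_pred : pred (C -> C^o) := fun X => `[< derivation X >].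

Lemma derivation_submod_closed : GRing.submod_closed derivation_pred.
Proof.
split=> [|f X Y /asboolP[Xl Xd] /asboolP[Yl Yd]].
  apply/asboolP; split=> [r a b|a b] /=; first by rewrite scaler0 addr0.
  by rewrite mul0r mulr0 addr0.
have ZM (r : R) (a b : C) : a * (r *: b) = r *: (a * b).
  by apply/val_inj/funext => p; rewrite /= mulrCA.
apply/asboolP; split=> [r a b|a b].
  rewrite /= -![(f *: X + Y) _]/(f * X _ + Y _) Xl Yl.
  by rewrite mulrDr ZM scalerDr addrACA.
rewrite /= -![(f *: X + Y) _]/(f * X _ + Y _) Xd Yd.
by rewrite !mulrDr mulrDl addrACA !mulrA [a * f]mulrC.
Qed.

HB.instance Definition _ :=
  GRing.isSubmodClosed.Build C (C -> C^o) derivation_pred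
    derivation_submod_closed.

Record vectorField := VectorField {
  vf_val :> C -> C^o;
  vf_valP : vf_val \in derivation_pred }.

HB.instance Definition _ := [isSub for vf_val].
HB.instance Definition _ := [Choice of vectorField by <:].
HB.instance Definition _ := [SubChoice_isSubZmodule of vectorField by <:].
HB.instance Definition _ := [SubZmodule_isSubLmodule of vectorField by <:].

Definition lie_fun (X Y : vectorField) : C -> C^o := fun f => X (Y f) - Y (X f).

Lemma lie_fun_derivation X Y : lie_fun X Y \in derivation_pred.
Proof.
have /asboolP[Xl Xd] := vf_valP X; have /asboolP[Yl Yd] := vf_valP Y.
have XB : {morph (X : C -> C) : a b / a + b}.
  by move=> a b; rewrite -[a]scale1r Xl !scale1r.
have YB : {morph (Y : C -> C) : a b / a + b}.
  by move=> a b; rewrite -[a]scale1r Yl !scale1r.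
apply/asboolP; split=> [r a b|a b]; rewrite /lie_fun.
  by rewrite Yl Xl Xl Yl scalerBr opprD addrACA.
rewrite Xd Yd XB YB !Xd !Yd mulrBl mulrBr !opprD.
rewrite [LHS](AC ((2*2)*(2*2)) (1*5*(2*7)*(3*6)*(4*8))) /=.
by rewrite !subrr !addr0.
Qed.

End VectorFields.

Definition lie_bracket (R : realType) (m : nat) (M : manifold R m)
    (X Y : vectorField M) : vectorField M :=
  VectorField (lie_fun_derivation X Y).

Section TensorCalculus.
Context {R : realType} {m : nat} {M : manifold R m}.
Local Notation C := (smoothFun M).
Local Notation V := (vectorField M).
Implicit Types (X Y Z T : V) (f : C) (F g : V -> V -> C).

(* X f p is the derivative of f at p along the tangent vector of X at p; this
   says that this tangent vector is zero. *)
Definition vanishes_at (p : M) X := forall f, X f p = 0.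

Definition bilinear_form F :=
  (forall Y, scalar (fun X => F X Y)) /\ (forall X, scalar (F X)).

Definition two_form F := bilinear_form F /\ forall X, F X X = 0.

Definition nondegenerate F :=
  forall (p : M) X, (forall Y, F X Y p = 0) -> vanishes_at p X.

Definition riemannian_metric g :=
  [/\ bilinear_form g, forall X Y, g X Y = g Y X &
      forall (p : M) X, ~ vanishes_at p X -> 0 < g X X p].

(* Exterior calculus is normalized by
   (dF)(X0,..,Xk) = sum_i (-1)^i Xi F(..) + ..., without a factor 1/(k+1),
   and accordingly a wedge product without factorials in the denominators. *)
Definition d1 (theta : V -> C) X Y : C :=
  X (theta Y) - Y (theta X) - theta (lie_bracket X Y).

Definition d2 F X Y Z : C :=
  X (F Y Z) + Y (F Z X) + Z (F X Y)
  - F (lie_bracket X Y) Z - F (lie_bracket Y Z) X - F (lie_bracket Z X) Y.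

Definition wedge12 (theta : V -> C) F X Y Z : C :=
  theta X * F Y Z + theta Y * F Z X + theta Z * F X Y.

Definition affine_connection (D : V -> V -> V) :=
  [/\ forall Y, linear (fun X => D X Y),
      forall X Y Z, D X (Y + Z) = D X Y + D X Z &
      forall X f Y, D X (f *: Y) = (X f : C) *: Y + f *: D X Y].

Definition levi_civita g (D : V -> V -> V) :=
  [/\ affine_connection D,
      forall X Y, D X Y - D Y X = lie_bracket X Y &
      forall X Y Z, X (g Y Z) = g (D X Y) Z + g Y (D X Z)].

Definition covariant_derivative1 (D : V -> V -> V) (theta : V -> C) X Y : C :=
  X (theta Y) - theta (D X Y).

Definition musical_dual g (theta : V -> C) T := forall X, g T X = theta X.

Definition nijenhuis (J : V -> V) X Y : V :=
  ((4^-1 : R) *: (1 : C)) *: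
    (lie_bracket (J X) (J Y) - lie_bracket X Y
     - J (lie_bracket (J X) Y) - J (lie_bracket X (J Y))).

Definition lie_derivative11 T (J : V -> V) X : V :=
  lie_bracket T (J X) - J (lie_bracket T X).

End TensorCalculus.

Record lcak (R : realType) (m : nat) (M : manifold R m) := LCAK {
  lcak_J : {linear vectorField M -> vectorField M};
  lcak_F : vectorField M -> vectorField M -> smoothFun M;
  lcak_theta : {scalar vectorField M};
  lcak_almost_complex : forall X, lcak_J (lcak_J X) = - X;
  lcak_two_form : two_form lcak_F;
  lcak_nondegenerate : nondegenerate lcak_F;
  lcak_closed : forall X Y, d1 lcak_theta X Y = 0;
  lcak_dF : forall X Y Z, d2 lcak_F X Y Z = wedge12 lcak_theta lcak_F X Y Z;
  lcak_riemannian : riemannian_metric (fun X Y => lcak_F X (lcak_J Y)) }.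

Section AntiPluricanonical.
Context {R : realType} {m : nat} {M : manifold R m} (S : lcak M).
Local Notation C := (smoothFun M).
Local Notation V := (vectorField M).
Local Notation J := (lcak_J S).

Definition lcak_metric (X Y : V) : C := lcak_F S X (J Y).

(* T and D stand for the dual of theta and the Levi-Civita connection, which
   are uniquely determined by the metric. *)
Definition anti_pluricanonical (T : V) (D : V -> V -> V) :=
  (forall (X Y : V) (a b : C),
     lcak_metric (nijenhuis J X Y) (a *: T + b *: J T) = 0) /\
  (forall X Y : V,
     covariant_derivative1 D (lcak_theta S) (J X) (J Y)
     = covariant_derivative1 D (lcak_theta S) X Y).

Definition holomorphic_field (T : V) := forall X, lie_derivative11 T J X = 0.

End AntiPluricanonical.

(* Main.v *)
Require Import Defs.
From mathcomp Require Import all_boot all_order all_algebra.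
From mathcomp Require Import all_classical all_reals all_analysis.
From mathcomp Require Import ring.

(* Write alpha = theta o J = - F(T, .).  As theta is closed,
   4 theta(N(X, Y)) = d alpha(JX, Y) + d alpha(X, JY), so N is orthogonal to
   Span(T, JT) iff d alpha is J-invariant; by Cartan's formula and
   dF = theta /\ F this holds iff L_T F is J-invariant.  Also
   L_T g = 2 D theta.  Hence g is anti-pluricanonical iff L_T F and L_T g are
   both J-invariant.  This is clear if L_T J = 0.  Conversely,
   L_T g = (L_T F)(., J .) + F(., (L_T J) .) shows that the last term is then
   J-invariant, but it is also J-anti-invariant because L_T J anticommutes
   with J; so it vanishes, and L_T J = 0 since F is nondegenerate. *)

Set Implicit Arguments.
Unset Strict Implicit.
Unset Printing Implicit Defensive.
Import GRing.Theory Num.Theory.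
Local Open Scope ring_scope.

(** * Algebra of vector fields, scalar forms and Lie derivatives of 2-tensors *)

Section VectorFieldAlgebra.
Context {R : realType} {m : nat} {M : manifold R m}.
Local Notation C := (smoothFun M).
Local Notation V := (vectorField M).
Implicit Types (X Y Z T : V) (f : C).

(** Index [k] cancels the factor k+1: [3] serves the 4 in 4N, and [1] the 2 in 2A = 0 and in L_T g =
    2 D theta. *)
Lemma smoothFun_mulrnI k : injective (fun f => f *+ k.+1).
Proof.
move=> f h /=.
rewrite -[f *+ _](scaler_nat (R := R)) -[h *+ _](scaler_nat (R := R)).
by apply: scalerI; rewrite pnatr_eq0.
Qed.

Lemma quarter_mulr4n f : ((4^-1 : R) *: (1 : C)) * f *+ 4 = f.
Proof.
rewrite -mulrnAl scalerMnl -[4^-1 *+ 4]mulr_natr mulVf ?pnatr_eq0 //.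
by rewrite scale1r mul1r.
Qed.

Lemma vectorFieldD X : {morph (X : C -> C) : a b / a + b}.
Proof.
have /asboolP[Xl _] := vf_valP X.
by move=> a b; rewrite -[a]scale1r Xl !scale1r.
Qed.

Lemma vectorField0 X : X 0 = 0 :> C.
Proof. by apply: (addrI (X 0 : C)); rewrite -vectorFieldD !addr0. Qed.

Lemma vectorFieldN X : {morph (X : C -> C) : a / - a}.
Proof.
move=> a; apply: (addrI (X a : C)).
by rewrite -vectorFieldD !subrr vectorField0.
Qed.

Lemma lie_bracketC X Y : lie_bracket X Y = - lie_bracket Y X.
Proof.
by apply/val_inj/funext => f; rewrite /= -[RHS]/(- lie_fun Y X f) opprB.
Qed.

Lemma lie_bracketNr X Y : lie_bracket X (- Y) = - lie_bracket X Y.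
Proof.
apply/val_inj/funext => f; rewrite /= -[RHS]/(- lie_fun X Y f) /lie_fun.
rewrite -![(- Y) _]/(- Y _); rewrite (vectorFieldN X (Y f : C)).
by rewrite opprB opprK addrC.
Qed.

Lemma lie_bracketNl X Y : lie_bracket (- X) Y = - lie_bracket X Y.
Proof. by rewrite lie_bracketC lie_bracketNr -lie_bracketC. Qed.

Lemma scalarD (h : V -> C) : scalar h -> {morph h : X Y / X + Y}.
Proof. by move=> hl X Y; rewrite -[X]scale1r hl !scale1r mul1r. Qed.

Lemma scalarN (h : V -> C) : scalar h -> {morph h : X / - X}.
Proof.
move=> hl X; have h0 : h 0 = 0.
  by apply: (addrI (h 0)); rewrite -scalarD // !addr0.
by apply: (addrI (h X)); rewrite -scalarD // !subrr.
Qed.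

Lemma alternating_skew (F : V -> V -> C) X Y : two_form F -> F X Y = - F Y X.
Proof.
move=> [[Fl Fr] Falt]; apply/eqP; rewrite -addr_eq0; apply/eqP.
have := Falt (X + Y).
by rewrite (scalarD (Fl _)) !(scalarD (Fr _)) !Falt addr0 add0r.
Qed.

Lemma nondegenerate_eq0 (F : V -> V -> C) Y :
  two_form F -> Defs.nondegenerate F -> (forall X, F X Y = 0) -> Y = 0.
Proof.
move=> F2 Fnd FY0; apply/val_inj/funext => f; apply/val_inj/funext => p.
by apply: Fnd => X; rewrite (alternating_skew _ _ F2) FY0 oppr0.
Qed.

(** The Lie derivative L_T B of a 2-tensor. *)
Definition lie_form T (B : V -> V -> C) X Y : C :=
  (T (B X Y) : C) - B (lie_bracket T X) Y - B X (lie_bracket T Y).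

(** Cartan's formula i_T dF = L_T F - d(i_T F), where [F T] is the contraction i_T F. *)
Lemma cartan_two_form (F : V -> V -> C) T X Y : two_form F ->
  d2 F T X Y = lie_form T F X Y - d1 (F T) X Y.
Proof.
move=> F2; have [[Fl Fr] _] := F2; have Fskew := alternating_skew _ _ F2.
rewrite /d2 /lie_form /d1 (Fskew Y T) vectorFieldN (Fskew _ T).
rewrite (lie_bracketC Y T) (scalarN (Fl X)) (Fskew (lie_bracket T Y)); ring.
Qed.

Lemma d1Nr (a : V -> C) X Y : {morph a : Z / - Z} ->
  d1 a X (- Y) = - d1 a X Y.
Proof.
move=> aN; rewrite /d1 lie_bracketNr !aN vectorFieldN.
rewrite -[(- Y) _]/(- Y _); ring.
Qed.

(** * Lie derivatives and the Nijenhuis tensor of an almost complex structure *)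

Section AlmostComplex.
Variable J : {linear V -> V}.
Hypothesis JJ : forall X, J (J X) = - X.

Definition J_invariant (B : V -> V -> C) := forall X Y, B (J X) (J Y) = B X Y.

(** This is L_T applied to J^2 = -1. *)
Lemma lie_derivative11_anticomm T X :
  lie_derivative11 T J (J X) = - J (lie_derivative11 T J X).
Proof.
by rewrite /lie_derivative11 JJ lie_bracketNr linearB /= JJ opprK opprD addrC.
Qed.

Lemma lie_form_J_invariant T (B : V -> V -> C) :
  (forall X, lie_derivative11 T J X = 0) ->
  J_invariant B -> J_invariant (lie_form T B).
Proof.
move=> hol BJ X Y; have TJ Z : lie_bracket T (J Z) = J (lie_bracket T Z).
  by apply/eqP; rewrite -subr_eq0; apply/eqP; exact: hol.
by rewrite /lie_form !TJ !BJ.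
Qed.

(** Leibniz rule for L_T on the contraction of F with J. *)
Lemma lie_form_compJ T (F : V -> V -> C) X Y : (forall Z, scalar (F Z)) ->
  lie_form T (fun Z W => F Z (J W)) X Y
  = lie_form T F X (J Y) + F X (lie_derivative11 T J Y).
Proof.
move=> Fr; rewrite /lie_form /lie_derivative11.
by rewrite (scalarD (Fr X)) (scalarN (Fr X)); ring.
Qed.

Lemma nijenhuis_mulr4n (theta : {scalar V}) X Y :
  theta (nijenhuis J X Y) *+ 4 =
  theta (lie_bracket (J X) (J Y)) - theta (lie_bracket X Y)
  - theta (J (lie_bracket (J X) Y)) - theta (J (lie_bracket X (J Y))).
Proof. by rewrite /nijenhuis linearZ /= quarter_mulr4n !linearB. Qed.

(** N is J-antilinear in its first argument; hence orthogonality to T will imply orthogonality to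
    JT. *)
Lemma nijenhuisJl (theta : {scalar V}) X Y :
  theta (nijenhuis J (J X) Y) = - theta (J (nijenhuis J X Y)).
Proof.
apply: (@smoothFun_mulrnI 3) => /=; rewrite mulNrn nijenhuis_mulr4n.
rewrite /nijenhuis !linearZ /= quarter_mulr4n !linearB /= !JJ.
rewrite !lie_bracketNl !(linearN J) !(linearN theta) /=; ring.
Qed.

(** The derivative terms on the left are those of [theta] on [JX, JY] and [X, Y], by closedness at
    (JX, JY) and (X, Y). *)
Lemma closed_nijenhuis (theta : {scalar V}) X Y :
  (forall Z W, d1 theta Z W = 0) ->
  d1 (theta \o J) (J X) Y + d1 (theta \o J) X (J Y)
  = theta (nijenhuis J X Y) *+ 4.
Proof.
move=> closed; rewrite nijenhuis_mulr4n /d1 /=.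
rewrite !JJ !(linearN theta) /= !vectorFieldN.
have := closed X Y; have := closed (J X) (J Y); rewrite /d1.
move=> /eqP; rewrite subr_eq0 => /eqP <-.
move=> /eqP; rewrite subr_eq0 => /eqP <-; ring.
Qed.

Lemma closed_nijenhuis_eq0 (theta : {scalar V}) :
  (forall Z W, d1 theta Z W = 0) ->
  (forall X Y, theta (nijenhuis J X Y) = 0) <-> J_invariant (d1 (theta \o J)).
Proof.
move=> closed.
have aN : {morph theta \o J : Z / - Z}.
  by move=> Z /=; rewrite (linearN J) (linearN theta).
split=> [N0 X Y|dJ X Y].
  (* Putting JY for Y turns the second summand into -d alpha(X, Y). *)
  have := closed_nijenhuis X (J Y) closed.
  by rewrite N0 mul0rn JJ d1Nr // => /eqP; rewrite subr_eq0 => /eqP.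
apply: (@smoothFun_mulrnI 3) => /=; rewrite mul0rn -closed_nijenhuis //.
by rewrite -(dJ X) JJ d1Nr // subrr.
Qed.

End AlmostComplex.

(** Metric compatibility and zero torsion give L_T g(X, Y) = (D theta)(X, Y) + (D theta)(Y, X);
    closedness of theta makes D theta symmetric. *)
Lemma lie_form_killing (g : V -> V -> C) (D : V -> V -> V) (theta : V -> C) T :
  bilinear_form g -> (forall X Y, g X Y = g Y X) -> levi_civita g D ->
  musical_dual g theta T -> (forall X Y, d1 theta X Y = 0) ->
  forall X Y, lie_form T g X Y = covariant_derivative1 D theta X Y *+ 2.
Proof.
move=> [gl gr] gC [_ torsion compat] dual closed X Y.
have DgE Z W : covariant_derivative1 D theta Z W = g (D Z T) W.
  by rewrite /covariant_derivative1 -!dual compat; ring.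
have DC : covariant_derivative1 D theta X Y = covariant_derivative1 D theta Y X.
  apply/eqP; rewrite -subr_eq0 -[X in _ == X](closed X Y).
  rewrite /covariant_derivative1 /d1 -torsion -!dual.
  rewrite (scalarD (gr T)) (scalarN (gr T)); apply/eqP; ring.
rewrite mulr2n {2}DC !DgE /lie_form compat -!torsion.
rewrite (scalarD (gl Y)) (scalarN (gl Y)) (scalarD (gr X)) (scalarN (gr X)).
by rewrite (gC (D Y T)); ring.
Qed.

End VectorFieldAlgebra.

(** * The two halves of the anti-pluricanonical condition *)

Section LCAK.
Context {R : realType} {m : nat} {M : manifold R m} (S : lcak M).
Local Notation C := (smoothFun M).
Local Notation V := (vectorField M).
Local Notation J := (lcak_J S).
Local Notation F := (lcak_F S).
Local Notation theta := (lcak_theta S).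
Local Notation g := (lcak_metric S).
Implicit Types (X Y Z : V).

Let JJ := lcak_almost_complex S.
Let F2 := lcak_two_form S.

Lemma lcak_metricC X Y : g X Y = g Y X.
Proof. by have [_ gC _] := lcak_riemannian S; exact: gC. Qed.

Lemma lcak_metric_bilinear : bilinear_form g.
Proof. by have [] := lcak_riemannian S. Qed.

(** A consequence of the symmetry of g = F(., J .) and J^2 = -1. *)
Lemma lcak_F_J_invariant : J_invariant J F.
Proof.
move=> X Y; have [[_ Fr] _] := F2.
rewrite -[LHS]/(g (J X) Y) lcak_metricC /lcak_metric JJ (scalarN (Fr Y)).
by rewrite -(alternating_skew _ _ F2).
Qed.

Lemma lcak_metric_J_invariant : J_invariant J g.
Proof. by move=> X Y; rewrite /lcak_metric lcak_F_J_invariant. Qed.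

Variable T : V.
Hypothesis T_dual : musical_dual g theta T.

Lemma lcak_F_dual X : F T X = - theta (J X).
Proof.
by rewrite -T_dual /lcak_metric JJ (scalarN (proj2 (proj1 F2) T)) opprK.
Qed.

(** Cartan's formula with i_T F = -alpha and i_T(theta /\ F) = theta(T) F + theta /\ alpha, both of
    whose terms are J-invariant. *)
Lemma lie_form_lcak_F X Y :
  lie_form T F X Y = theta T * F X Y + theta X * theta (J Y)
                     - theta Y * theta (J X) - d1 (theta \o J) X Y.
Proof.
have := cartan_two_form T X Y F2.
rewrite lcak_dF /wedge12 (alternating_skew Y T F2) /d1 !lcak_F_dual.
rewrite !vectorFieldN /= => /eqP; rewrite -subr_eq0 => /eqP E.
apply/eqP; rewrite -subr_eq0 -oppr_eq0 -[X in _ == X]E; apply/eqP; ring.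
Qed.

Lemma lie_form_lcak_F_J_invariant :
  J_invariant J (lie_form T F) <-> J_invariant J (d1 (theta \o J)).
Proof.
split=> inv X Y; have := inv X Y; rewrite !lie_form_lcak_F.
  rewrite lcak_F_J_invariant !JJ !(linearN theta) /= => E.
  apply: oppr_inj; apply: (addrI (theta T * F X Y + theta X * theta (J Y)
                                 - theta Y * theta (J X))).
  by rewrite -E; ring.
by move=> ->; rewrite lcak_F_J_invariant !JJ !(linearN theta) /=; ring.
Qed.

Lemma nijenhuis_orthogonal :
  (forall X Y (a b : C), g (nijenhuis J X Y) (a *: T + b *: J T) = 0) <->
  J_invariant J (lie_form T F).
Proof.
rewrite lie_form_lcak_F_J_invariant.
rewrite -(closed_nijenhuis_eq0 JJ (@lcak_closed _ _ _ S)).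
have [gl gr] := lcak_metric_bilinear.
split=> [ortho X Y|N0 X Y a b].
  by rewrite -T_dual lcak_metricC -(ortho X Y 1 0) scale1r scale0r addr0.
have gT Z : g Z T = theta Z by rewrite lcak_metricC T_dual.
have gJT Z : g Z (J T) = - theta (J Z).
  by rewrite -lcak_metric_J_invariant JJ (scalarN (gr _)) gT.
(* The added 0 gives [b *: J T] the shape [gr] expects; what remains is g(N(X, Y), 0) = 0. *)
rewrite gr -[b *: J T]addr0 gr gT gJT -nijenhuisJl // !N0 !mulr0 !add0r.
by apply: (addrI (g (nijenhuis J X Y) 0)); rewrite -(scalarD (gr _)) !addr0.
Qed.

Lemma holomorphic_of_lie_forms :
  J_invariant J (lie_form T F) -> J_invariant J (lie_form T g) ->
  holomorphic_field S T.
Proof.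
have [[Fl Fr] _] := F2; move=> LF Lg Y.
apply: (nondegenerate_eq0 F2 (@lcak_nondegenerate _ _ _ S)) => X.
have := Lg X Y; rewrite /lcak_metric !lie_form_compJ // LF => /addrI.
(* With A(X, Y) = F(X, (L_T J)Y), invariance reads A(JX, JY) = A(X, Y), and anticommutation gives
   A(JX, JY) = -A(X, Y). *)
rewrite lie_derivative11_anticomm // (scalarN (Fr _)) lcak_F_J_invariant.
move=> /eqP; rewrite eq_sym -addr_eq0 -mulr2n => /eqP A0.
by apply: (@smoothFun_mulrnI _ _ _ 1) => /=; rewrite A0 mul0rn.
Qed.

End LCAK.

Theorem proposition24 (R : realType) (n : nat) (M : manifold R n.*2)
    (S : lcak M) (T : vectorField M)
    (D : vectorField M -> vectorField M -> vectorField M)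
    (T_dual : musical_dual (lcak_metric S) (lcak_theta S) T)
    (D_levi_civita : levi_civita (lcak_metric S) D) :
  anti_pluricanonical S T D <-> holomorphic_field S T.
Proof.
have killing := lie_form_killing (lcak_metric_bilinear S) (lcak_metricC S)
  D_levi_civita T_dual (@lcak_closed _ _ _ S).
rewrite /anti_pluricanonical nijenhuis_orthogonal //.
split=> [[LF DJ]|hol].
  by apply: holomorphic_of_lie_forms => // X Y; rewrite !killing DJ.
split; first exact: lie_form_J_invariant hol (lcak_F_J_invariant S).
move=> X Y; apply: (@smoothFun_mulrnI _ _ _ 1) => /=; rewrite -!killing.
exact: lie_form_J_invariant hol (lcak_metric_J_invariant S) X Y.
Qed.
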